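(* Let $\rho>0$, let $\mathcal X,\mathcal Y,\mathcal M_1,\mathcal M_2$ be finite nonempty sets, and let $(X,Y)$ be drawn from $\mathcal X\times\mathcal Y$ according to the PMF $P_{X,Y}$. Put $\tilde\rho=1/(1+\rho)$. For an encoder (a conditional PMF of $(M_1,M_2)\in\mathcal M_1\times\mathcal M_2$ given $(X,Y)$), let $\mathscr A_{\mathrm B}^{(\mathrm l)}(P_{X,Y})$ and $\mathscr A_{\mathrm E}(P_{X,Y})$ be Bob's list ambiguity and Eve's ambiguity as defined in the context. (Direct part.) If $|\mathcal M_1||\mathcal M_2|>\log|\mathcal X|+2$, then for every triple of positive integers $(c_s,c_1,c_2)$ satisfying $$c_s\le \min\{|\mathcal M_1|,|\mathcal M_2|\},\quad c_1\le \lfloor |\mathcal M_1|/c_s\rfloor,\quad c_2\le\lfloor |\mathcal M_2|/c_s\rfloor,\quad c_sc_1c_2>\log|\mathcal X|+2,$$ there is an encoder for which both $$\mathscr A_{\mathrm B}^{(\mathrm l)}(P_{X,Y})<1+2^{\rho\left(H_{\tilde\rho}(X|Y)-\log(c_sc_1c_2-\log|\mathcal X|-2)+2\right)}$$ and $$\mathscr A_{\mathrm E}(P_{X,Y})\ge (1+\ln|\mathcal X|)^{-\rho}\,2^{\rho\left(H_{\tilde\rho}(X|Y)-\log(c_1+c_2)\right)} .$$ (Converse part.) For every encoder, $$\mathscr A_{\mathrm B}^{(\mathrm l)}(P_{X,Y})\ge \max\left\{2^{\rho\left(H_{\tilde\rho}(X|Y)-\log(|\mathcal M_1||\mathcal M_2|)\right)},\,1\right\}$$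 and $$\mathscr A_{\mathrm E}(P_{X,Y})\le\min\left\{\min\{|\mathcal M_1|^\rho,|\mathcal M_2|^\rho\}\,\mathscr A_{\mathrm B}^{(\mathrm l)}(P_{X,Y}),\;2^{\rho H_{\tilde\rho}(X|Y)}\right\}.$$
   Context: Logarithms $\log$ are to base 2; $\ln$ is the natural logarithm. Encoder: a conditional PMF $\mathbb P[M_1=m_1,M_2=m_2\mid X=x,Y=y]$ on $\mathcal M_1\times\mathcal M_2$ for each $(x,y)\in\mathcal X\times\mathcal Y$; together with $P_{X,Y}$ it determines the joint law of $(X,Y,M_1,M_2)$. Lists and Bob's ambiguity (list version): for $y\in\mathcal Y$ and $(m_1,m_2)\in\mathcal M_1\times\mathcal M_2$, $\mathcal L^y_{m_1,m_2}=\{x\in\mathcal X:\ \mathbb P[X=x\mid Y=y,M_1=m_1,M_2=m_2]>0\}$ (equivalently, the set of $x$ with $P_{X,Y}(x,y)\,\mathbb P[M_1=m_1,M_2=m_2|X=x,Y=y]>0$), and $\mathscr A_{\mathrm B}^{(\mathrm l)}(P_{X,Y})=\mathbb E\left[|\mathcal L^Y_{M_1,M_2}|^\rho\right]$. Guessing function: for side information $W$ taking values in a finite set $\mathcal W$, a guessing function $G(\cdot|W)$ for $X$ is a choice, for each $w\in\mathcal W$, of a bijection $G(\cdot|w):\mathcal X\to\{1,\dots,|\mathcal X|\}$. Eve's ambiguity: $\mathscr A_{\mathrm E}(P_{X,Y})=\min_{G_1,G_2}\mathbb E\left[\min\{G_1(X|Y,M_1)^\rho,\,G_2(X|Y,M_2)^\rho\}\right]$,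 the outer minimum being over guessing functions $G_1$ with side information $(Y,M_1)$ and $G_2$ with side information $(Y,M_2)$. Conditional Rényi entropy (Arimoto) of order $\alpha\in(0,1)$: $H_\alpha(X|Y)=\frac{\alpha}{1-\alpha}\log\sum_{y\in\mathcal Y}\left(\sum_{x\in\mathcal X}P_{X,Y}(x,y)^\alpha\right)^{1/\alpha}$. *)

(* Defs.v *)
From mathcomp Require Export all_boot all_order all_algebra.
From mathcomp Require Export all_classical all_reals all_analysis.

Set Implicit Arguments.
Unset Strict Implicit.
Unset Printing Implicit Defensive.

Import Order.TTheory GRing.Theory Num.Theory.
Local Open Scope ring_scope.

Definition log2 {R : realType} (x : R) : R := ln x / ln 2.

Definition is_pmf {R : realType} (T : finType) (p : T -> R) : Prop :=
  (forall t, 0 <= p t) /\ \sum_t p t = 1.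

(* [e x y (m1, m2)] is P[M1 = m1, M2 = m2 | X = x, Y = y]. *)
Definition is_encoder {R : realType} (X Y M1 M2 : finType)
    (e : X -> Y -> M1 * M2 -> R) : Prop :=
  forall x y, is_pmf (e x y).

Definition joint {R : realType} (X Y M1 M2 : finType) (P : X * Y -> R)
    (e : X -> Y -> M1 * M2 -> R) (x : X) (y : Y) (m1 : M1) (m2 : M2) : R :=
  P (x, y) * e x y (m1, m2).

Definition expectation {R : realType} (X Y M1 M2 : finType) (P : X * Y -> R)
    (e : X -> Y -> M1 * M2 -> R) (f : X -> Y -> M1 -> M2 -> R) : R :=
  \sum_x \sum_y \sum_m1 \sum_m2 joint P e x y m1 m2 * f x y m1 m2.

(* P[X = x | Y = y, M1 = m1, M2 = m2]; since 0 / 0 = 0, it vanishes for every x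
   when the conditioning event has probability zero. *)
Definition posterior {R : realType} (X Y M1 M2 : finType) (P : X * Y -> R)
    (e : X -> Y -> M1 * M2 -> R) (x : X) (y : Y) (m1 : M1) (m2 : M2) : R :=
  joint P e x y m1 m2 / \sum_x' joint P e x' y m1 m2.

Definition bob_list {R : realType} (X Y M1 M2 : finType) (P : X * Y -> R)
    (e : X -> Y -> M1 * M2 -> R) (y : Y) (m1 : M1) (m2 : M2) : {set X} :=
  [set x | 0 < posterior P e x y m1 m2].

Definition bob_ambiguity {R : realType} (rho : R) (X Y M1 M2 : finType)
    (P : X * Y -> R) (e : X -> Y -> M1 * M2 -> R) : R :=
  expectation P e (fun _ y m1 m2 => #|bob_list P e y m1 m2|%:R `^ rho).

(* Guesses are stored 0-based, in 'I_#|X|; [guess G x w] is the 1-based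
   number of guesses G(x|w). *)
Notation guess_table X W := {ffun W -> {ffun X -> 'I_#|X|}}.

Definition is_guessing (X W : finType) (G : guess_table X W) : bool :=
  [forall w, `[< bijective (G w) >]].

Definition guess (X W : finType) (G : guess_table X W) (x : X) (w : W) : nat :=
  (G w x).+1.

Definition guess0 (X W : finType) : guess_table X W :=
  [ffun=> [ffun x => enum_rank x]].

Lemma guess0_is_guessing (X W : finType) : is_guessing (guess0 X W).
Proof.
apply/forallP => w; apply/asboolP.
by exists enum_val => x; rewrite !ffunE ?enum_rankK ?enum_valK.
Qed.

Definition eve_cost {R : realType} (rho : R) (X Y M1 M2 : finType)
    (P : X * Y -> R) (e : X -> Y -> M1 * M2 -> R)
    (G : guess_table X (Y * M1)%type * guess_table X (Y * M2)%type) : R :=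
  expectation P e (fun x y m1 m2 =>
    Num.min ((guess G.1 x (y, m1))%:R `^ rho) ((guess G.2 x (y, m2))%:R `^ rho)).

(* [guess0] only provides the feasible starting point required by [arg min]. *)
Definition eve_ambiguity {R : realType} (rho : R) (X Y M1 M2 : finType)
    (P : X * Y -> R) (e : X -> Y -> M1 * M2 -> R) : R :=
  eve_cost rho P e
    [arg min_(G < (guess0 X (Y * M1)%type, guess0 X (Y * M2)%type)
               | is_guessing G.1 && is_guessing G.2) eve_cost rho P e G]%O.

Lemma eve_ambiguityP {R : realType} (rho : R) (X Y M1 M2 : finType)
    (P : X * Y -> R) (e : X -> Y -> M1 * M2 -> R) :
  (exists G1 G2, [/\ is_guessing G1, is_guessing G2
     & eve_ambiguity rho P e = eve_cost rho P e (G1, G2)]) /\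
  (forall G1 G2, is_guessing G1 -> is_guessing G2 ->
     eve_ambiguity rho P e <= eve_cost rho P e (G1, G2)).
Proof.
rewrite /eve_ambiguity; case: arg_minP => /=; first by rewrite !guess0_is_guessing.
move=> [G1 G2] /= /andP[g1 g2] Gmin; split; first by exists G1, G2.
by move=> H1 H2 h1 h2; apply: Gmin; rewrite /= h1 h2.
Qed.

(* Arimoto's conditional Renyi entropy H_alpha(X|Y), for 0 < alpha < 1. *)
Definition renyi_entropy {R : realType} (alpha : R) (X Y : finType)
    (P : X * Y -> R) : R :=
  alpha / (1 - alpha) *
  log2 (\sum_y (\sum_x P (x, y) `^ alpha) `^ (alpha^-1)).

(* Main.v *)
(** With S_y = (\sum_x P(x,y)^(1/(1+rho)))^(1+rho), one has
    2^(rho H) = \sum_y S_y. If ranks or list sizes g_i are attached to weights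
    p_i, Hoelder's inequality gives
    (\sum p_i^(1/(1+rho)))^(1+rho) <= (\sum p_i g_i^rho) (\sum 1/g_i)^rho,
    so every lower bound amounts to an estimate of a sum of reciprocals. For
    Bob's lists the reciprocals sum to at most 1 per message. Eve's upper
    bounds come from explicit guessing orders: by decreasing probability, or by
    the size of the smallest compatible list.

    For the direct part, (V_s, V_1, V_2) is the index, among c_s c_1 c_2 blocks
    depending on y, of the block containing x; the sizes of the blocks are
    controlled by a dyadic cutting of the source alphabet. With U uniform on
    Z/c_s, the messages are M_1 = (V_s + U, V_1) and M_2 = (U, V_2). Eve's two
    guesses are bounded through Hoelder's inequality over the pairs (x, u),
    where 1/min(g_1, g_2) <= 1/g_1 + 1/g_2 sums to at most
    c_s (c_1 + c_2) (1 + ln |X|). *)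
Require Import Defs.
From mathcomp Require Import ring lra.

Set Implicit Arguments.
Unset Strict Implicit.
Unset Printing Implicit Defensive.

Import Order.TTheory GRing.Theory Num.Theory.
Local Open Scope ring_scope.

(** * Real powers: weighted means and Hoelder's inequality *)

Lemma powR2_log2 (R : realType) (x : R) : 0 < x -> 2 `^ log2 x = x.
Proof.
move=> x_gt0; rewrite /powR pnatr_eq0 /= /log2 divfK ?lnK//.
by rewrite gt_eqF// ln_gt0// ltr1n.
Qed.

(** Young's inequality for the conjugate exponents [1 / alpha] and [1 / (1 - alpha)]. *)
Lemma weighted_AMGM (R : realType) (alpha a b : R) :
  0 < alpha < 1 -> 0 <= a -> 0 <= b ->
  a `^ alpha * b `^ (1 - alpha) <= alpha * a + (1 - alpha) * b.
Proof.
move=> /andP[alpha_gt0 alpha_lt1] a_ge0 b_ge0.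
have beta_gt0 : 0 < 1 - alpha by rewrite subr_gt0.
have := @conjugate_powR R (a `^ alpha) (b `^ (1 - alpha)) alpha^-1 (1 - alpha)^-1.
rewrite !invr_gt0 !invrK subrKC -!powRrM !mulfV ?gt_eqF// !powRr1//.
by rewrite ![_ * alpha]mulrC ![_ * (1 - alpha)]mulrC; apply; rewrite ?powR_ge0.
Qed.

(** After division by the two totals, weighted AM-GM applies termwise; if a total is zero, its terms
    vanish and so does the left side. *)
Lemma Holder_sum (R : realType) (alpha : R) (I : finType) (A : pred I)
    (a b : I -> R) :
  0 < alpha < 1 -> (forall i, 0 <= a i) -> (forall i, 0 <= b i) ->
  \sum_(i | A i) a i `^ alpha * b i `^ (1 - alpha) <=
  (\sum_(i | A i) a i) `^ alpha * (\sum_(i | A i) b i) `^ (1 - alpha).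
Proof.
move=> alpha01 a_ge0 b_ge0.
have [alpha_neq0 beta_neq0] : alpha != 0 /\ 1 - alpha != 0.
  by case/andP: alpha01 => ? ?; rewrite !gt_eqF// subr_gt0.
set SA := \sum_(i | A i) a i; set SB := \sum_(i | A i) b i.
have SA_ge0 : 0 <= SA by exact: sumr_ge0.
have SB_ge0 : 0 <= SB by exact: sumr_ge0.
have [SA0|SA_neq0] := eqVneq SA 0.
  rewrite big1 ?mulr_ge0 ?powR_ge0// => i Ai.
  by rewrite (psumr_eq0P _ SA0)// powR0// mul0r.
have [SB0|SB_neq0] := eqVneq SB 0.
  rewrite big1 ?mulr_ge0 ?powR_ge0// => i Ai.
  by rewrite (psumr_eq0P _ SB0)// (powR0 beta_neq0) mulr0.
have SA_gt0 : 0 < SA by rewrite lt_def SA_neq0.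
have SB_gt0 : 0 < SB by rewrite lt_def SB_neq0.
have sum1 : \sum_(i | A i) (alpha * (a i / SA) + (1 - alpha) * (b i / SB)) = 1.
  by rewrite big_split /= -!mulr_sumr -!mulr_suml -/SA -/SB !mulfV// !mulr1 subrKC.
rewrite -[leRHS]mulr1 -[X in _ <= _ * X]sum1.
rewrite mulr_sumr ler_sum// => i _.
rewrite -{1}[a i](divfK SA_neq0) -{1}[b i](divfK SB_neq0).
have ? : 0 <= a i / SA by rewrite divr_ge0.
have ? : 0 <= b i / SB by rewrite divr_ge0.
rewrite (powRM _ _ SA_ge0)// (powRM _ _ SB_ge0)// mulrACA mulrC.
rewrite ler_wpM2l ?mulr_ge0 ?powR_ge0//.
exact: weighted_AMGM.
Qed.

Lemma order_in01 (R : realType) (rho : R) : 0 < rho -> 0 < 1 / (1 + rho) < 1.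
Proof.
move=> rho_gt0; have ? : 0 < 1 + rho by rewrite addr_gt0.
by rewrite divr_gt0//= ltr_pdivrMr// mul1r ltrDl.
Qed.

(** Turns a bound [t / p ^ (1 / (1 + rho))] on a rank or a block size into a cost, since
    [1 - rho / (1 + rho) = 1 / (1 + rho)]. *)
Lemma mul_powR_div (R : realType) (rho p t : R) : 0 < rho -> 0 <= p -> 0 <= t ->
  p * (t / p `^ (1 / (1 + rho))) `^ rho = p `^ (1 / (1 + rho)) * t `^ rho.
Proof.
move=> rho_gt0 p_ge0 t_ge0; have /andP[alpha_gt0 _] := order_in01 rho_gt0.
have [->|p_neq0] := eqVneq p 0; first by rewrite powR0 ?mul0r// gt_eqF.
rewrite powRM ?invr_ge0 ?powR_ge0// mulrCA mulrC; congr (_ * _).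
have rho1 : 1 + rho != 0 by rewrite gt_eqF// addr_gt0.
rewrite -powRN -powRrM -{1}[p]powRr1// -powRD ?p_neq0 ?implybT//.
by congr (_ `^ _); field.
Qed.

(* The core inequality of all lower bounds: Hoelder applied to
   [p ^ alpha = (p g ^ rho) ^ alpha * (1 / g) ^ (1 - alpha)]. *)
Lemma powR_sum_le (R : realType) (rho : R) (I : finType) (A : pred I)
    (p g : I -> R) :
  0 < rho -> (forall i, 0 <= p i) -> (forall i, 0 <= g i) ->
  (forall i, A i -> g i != 0) ->
  (\sum_(i | A i) p i `^ (1 / (1 + rho))) `^ (1 + rho) <=
  (\sum_(i | A i) p i * g i `^ rho) * (\sum_(i | A i) (g i)^-1) `^ rho.
Proof.
move=> rho_gt0 p_ge0 g_ge0 g_neq0; have alpha01 := order_in01 rho_gt0.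
have rho1_gt0 : 0 < 1 + rho by rewrite addr_gt0.
have rho1_neq0 : 1 + rho != 0 by rewrite gt_eqF.
have pg_ge0 i : 0 <= p i * g i `^ rho by rewrite mulr_ge0 ?powR_ge0.
have h_ge0 i : 0 <= (g i)^-1 by rewrite invr_ge0.
have betaE : 1 - 1 / (1 + rho) = rho / (1 + rho).
  by field.
have -> : \sum_(i | A i) p i `^ (1 / (1 + rho)) = \sum_(i | A i)
    (p i * g i `^ rho) `^ (1 / (1 + rho)) * (g i)^-1 `^ (1 - 1 / (1 + rho)).
  apply: eq_bigr => i Ai; rewrite powRM ?powR_ge0// -mulrA betaE.
  rewrite -powRrM mul1r -[(g i)^-1]powR_inv1// -[(_ `^ (-1)) `^ _]powRrM mulN1r.
  by rewrite -powRD ?g_neq0 ?implybT// subrr powRr0 mulr1.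
have := Holder_sum A alpha01 pg_ge0 h_ge0.
set S := \sum_(_ | _) _ => S_le.
have S_ge0 : 0 <= S by rewrite sumr_ge0// => i _; rewrite mulr_ge0 ?powR_ge0.
apply: (le_trans (ge0_ler_powR (ltW rho1_gt0) _ _ S_le)).
- by rewrite nnegrE.
- by rewrite nnegrE mulr_ge0 ?powR_ge0.
rewrite powRM ?powR_ge0// -!powRrM betaE !divfK// powRr1//.
by rewrite sumr_ge0.
Qed.

(** * Harmonic sums and guessing orders given by keys *)

(** By induction; adding the term [1 / (n + 2)] uses [ln (1 + x) <= x] at [x = - 1 / (n + 2)]. *)
Lemma harmonic_le (R : realType) (n : nat) : (0 < n)%N ->
  \sum_(i < n) (i.+1%:R : R)^-1 <= 1 + ln n%:R.
Proof.
case: n => // n _; elim: n => [|n IHn].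
  by rewrite big_ord_recr big_ord0 /= add0r invr1 ln1 addr0.
rewrite big_ord_recr /=; apply: (le_trans (lerD IHn (lexx _))).
rewrite -addrA lerD2l -lerBrDl.
have ? : 0 < n.+1%:R :> R by rewrite ltr0n.
have ? : 0 < n.+2%:R :> R by rewrite ltr0n.
rewrite -ln_div ?posrE// -[ln _]opprK -lnV ?posrE ?divr_gt0// invf_div.
rewrite lerNr.
have -> : n.+1%:R / n.+2%:R = 1 + - n.+2%:R^-1 :> R.
  by rewrite -[n.+1%:R](addrK 1) natr1 mulrBl mulfV ?pnatr_eq0// mul1r.
by rewrite le_ln1Dx// ltrN2 invf_lt1// ltr1n.
Qed.

(** The rank is the position in a list sorted by [k]: everything up to the position of [x] has a key
    at most [k x]. *)
Lemma exists_ranking (R : realType) (X : finType) (k : X -> R) :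
  exists G : {ffun X -> 'I_#|X|}, bijective G /\
    forall x, ((G x).+1 <= #|[set x' | (k x' <= k x)%R]|)%N.
Proof.
pose le x y := (k x <= k y)%R; pose s := sort le (enum X).
have s_uniq : uniq s by rewrite sort_uniq enum_uniq.
have s_size : size s = #|X| by rewrite size_sort -cardE.
have s_mem x : x \in s by rewrite mem_sort mem_enum.
have index_lt x : (index x s < #|X|)%N by rewrite -s_size index_mem.
exists [ffun x => Ordinal (index_lt x)]; split.
  apply: inj_card_bij; last by rewrite card_ord.
  move=> x y; rewrite !ffunE => /(congr1 val) /= /(congr1 (nth x s)).
  by rewrite !nth_index.
move=> x; rewrite ffunE /=.
have le_s : sorted le s by apply: sort_sorted => a b; exact: le_total.
have <- : #|[set y in take (index x s).+1 s]| = (index x s).+1.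
  by rewrite cardsE (card_uniqP _) ?take_uniq// size_takel// s_size.
apply: subset_leq_card; apply/fintype.subsetP => y.
rewrite !inE in_take// ltnS => le_yx.
rewrite -[y](nth_index x (s_mem y)) -[x in leRHS](nth_index x (s_mem x)).
apply: (sorted_leq_nth _ _ x le_s); rewrite ?inE ?index_mem//.
- by move=> b a c; exact: le_trans.
- by move=> a; exact: lexx.
Qed.

Lemma exists_guessing (R : realType) (X W : finType) (k : W -> X -> R) :
  exists G : guess_table X W, is_guessing G /\
    forall x w, (guess G x w <= #|[set x' | (k w x' <= k w x)%R]|)%N.
Proof.
have /fin_all_exists[G GP] w := exists_ranking (k w).
exists [ffun w => G w]; split.
  by apply/forallP => w; apply/asboolP; rewrite ffunE; case: (GP w).
by move=> x w; rewrite /guess ffunE; case: (GP w).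
Qed.

Lemma leq_card_bigcup (X J : finType) (A : pred J) (L : J -> {set X}) (n : nat) :
  (forall j, A j -> #|L j| <= n)%N -> (#|\bigcup_(j | A j) L j| <= #|J| * n)%N.
Proof.
move=> L_le; apply: (@leq_trans (\sum_(j | A j) #|L j|)).
  elim/big_rec2: _ => [|j m S _ ?]; first by rewrite cards0.
  by rewrite (leq_trans (leq_card_setU _ _))// leq_add2l.
rewrite -sum_nat_const big_mkcond leq_sum// => j _.
by case: ifP => // Aj; exact: L_le.
Qed.

(* The key of [x] is the size of the smallest list containing it: guessing
   in increasing order of keys exhausts the short lists first. *)
Lemma exists_list_key (R : realType) (X J : finType) (L : J -> {set X}) :
  exists k : X -> R, forall x j, x \in L j ->
    (#|[set x' | (k x' <= k x)%R]| <= #|J| * #|L j|)%N.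
Proof.
(* The default exceeds every list size, so an element of no list gets a larger key than any listed
   one. *)
pose k x : R := \big[Num.min/#|X|.+1%:R]_(j | x \in L j) #|L j|%:R.
exists k => x j xLj.
have kx_le : k x <= #|L j|%:R by exact: bigmin_le_cond.
apply: (@leq_trans #|\bigcup_(i | (#|L i| <= #|L j|)%N) L i|).
  apply: subset_leq_card; apply/fintype.subsetP => x'; rewrite inE => kx'.
  have : ~~ (#|L j|%:R < k x') by rewrite -leNgt (le_trans kx').
  apply: contraR => x'N; apply/bigmin_gtP; split.
    by rewrite ltr_nat ltnS max_card.
  move=> i x'Li; rewrite ltr_nat ltnNge; apply: contra x'N => le_ij.
  by apply/bigcupP; exists i.
exact: leq_card_bigcup.
Qed.

(** * Block coding by dyadic classes *)

Lemma up_log_le_log2 (R : realType) (n : nat) : (0 < n)%N ->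
  (up_log 2 n)%:R <= log2 n%:R + 1 :> R.
Proof.
case: n => [|[|n]]// _; first by rewrite up_log1 /log2 ln1 mul0r add0r.
have : (2 ^ (up_log 2 n.+2).-1 < n.+2)%N by rewrite up_log_gtn.
have : (0 < up_log 2 n.+2)%N by rewrite up_log_gt0.
case: (up_log _ _) => // j _ /= lt_n; rewrite -natr1 lerD2r.
rewrite ler_pdivlMr ?ln_gt0 ?ltr1n// -ln_powR.
rewrite powR_mulrn// ler_ln ?posrE ?exprn_gt0 ?ltr0n// -natrX ler_nat.
exact: ltnW.
Qed.

Lemma exists_injection (A B : finType) : (#|A| <= #|B|)%N ->
  exists f : A -> B, injective f.
Proof.
move=> leAB; exists (fun a => enum_val (widen_ord leAB (enum_rank a))).
move=> a b /enum_val_inj /(congr1 val) /= /val_inj; exact: enum_rank_inj.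
Qed.

(* The elements whose bound [1 / w x] lies in [2 ^ i, 2 ^ i.+1) are cut into
   blocks of size [2 ^ i]; all elements with bound at least [#|X|] share one
   further block. *)
Lemma exists_task_encoder (R : realType) (X Z : finType) (w : X -> R) :
  (0 < #|X|)%N -> (forall x, 0 <= w x) ->
  2 * \sum_x w x + log2 #|X|%:R + 2 <= #|Z|%:R ->
  exists f : X -> Z, forall x, 0 < w x ->
    #|[set x' | f x' == f x]|%:R <= Num.max 1 (w x)^-1.
Proof.
move=> X_gt0 w_ge0 Z_ge; pose J := up_log 2 #|X|.
(* Weight zero stands for an infinite bound, hence for the last class [J]. *)
pose j x := if 0 < w x then trunc_log 2 (Num.truncn (w x)^-1) else J.
have c_lt x : (minn (j x) J < J.+1)%N by rewrite ltnS geq_minr.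
pose c x : 'I_J.+1 := Ordinal (c_lt x).
have c_up x : 0 < w x -> (2 ^ c x)%:R <= Num.max 1 (w x)^-1.
  move=> wx_gt0; have : (2 ^ c x <= 2 ^ j x)%N by rewrite leq_exp2l// geq_minl.
  rewrite -(ler_nat R) => /le_trans; apply; rewrite /j wx_gt0 le_max.
  (* For [w x > 1] the bound truncates to 0; the class is then 0, with blocks of size 1, which the 1
     in the maximum covers. *)
  case: (posnP (Num.truncn (w x)^-1)) => [->|pos]; first by rewrite trunc_log0 lexx.
  have := trunc_logP (isT : 1 < 2)%N pos; rewrite -(ler_nat R) => /le_trans le_j.
  by rewrite orbC le_j// truncn_le invr_ge0.
have c_lo x : (c x < J)%N -> ((2 ^ c x)%:R)^-1 <= 2 * w x.
  rewrite /= gtn_min ltnn orbF => lt_J; rewrite (minn_idPl (ltnW lt_J)).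
  move: lt_J; rewrite /j; case: ifP => [wx_gt0 _|]; last by rewrite ltnn.
  have := trunc_log_ltn (Num.truncn (w x)^-1) (isT : 1 < 2)%N.
  rewrite -(ler_nat R) expnS natrM => /(lt_le_trans (truncnS_gt _))/ltW.
  set m := (_ ^ _)%:R; have m_gt0 : 0 < m by rewrite ltr0n expn_gt0.
  by rewrite -ler_pdivrMl// -lef_pV2 ?posrE ?mulr_gt0 ?invr_gt0// invfM !invrK.
pose Xc (i : 'I_J.+1) := [set x | c x == i].
(* The last class has at most [#|X| <= 2 ^ J] elements and fits in one block; any other class may
   leave one block incomplete, hence the successor. *)
pose n_ (i : 'I_J.+1) := if i == ord_max then 1%N else (#|Xc i| %/ 2 ^ i).+1.
pose r x := index x (enum (Xc (c x))).
have r_lt x : (r x < #|Xc (c x)|)%N by rewrite cardE index_mem mem_enum inE.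
have q_lt x : (r x %/ 2 ^ c x < n_ (c x))%N.
  rewrite /n_; case: eqP => [cJ|_].
    rewrite ltn_divLR ?expn_gt0// mul1n (leq_trans (r_lt x))//.
    by rewrite (leq_trans (max_card _))// cJ up_logP.
  by rewrite ltnS leq_div2r// ltnW.
pose code x : {i : 'I_J.+1 & 'I_(n_ i)} :=
  Tagged (fun i => 'I_(n_ i)) (Ordinal (q_lt x)).
have /exists_injection[h h_inj] : (#|{: {i : 'I_J.+1 & 'I_(n_ i)}}| <= #|Z|)%N.
  rewrite card_tagged sumnE big_map big_enum -(ler_nat R) natr_sum.
  under eq_bigr do rewrite card_ord.
  apply: le_trans Z_ge.
  (* Outside the last class [1 / 2 ^ i <= 2 * w x], so the blocks of class [i] number at most its
     sum of [2 * w x], plus 1. The [J + 1] extra ones, with [J <= log |X| + 1], give the term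
     [log |X| + 2]. *)
  apply: (@le_trans _ _ (\sum_i (\sum_(x | c x == i) 2 * w x + 1))).
    apply: ler_sum => i _; rewrite /n_; case: eqP => [_|/eqP iJ].
      by rewrite lerDr sumr_ge0// => x _; rewrite mulr_ge0.
    rewrite -natr1 lerD2r; apply: (@le_trans _ _ (#|Xc i|%:R / (2 ^ i)%:R)).
      by rewrite ler_pdivlMr ?ltr0n ?expn_gt0// -natrM ler_nat leq_trunc_div.
    rewrite cardsE -sum1_card natr_sum mulr_suml ler_sum// => x /eqP cx.
    rewrite mul1r -cx c_lo// cx ltn_neqAle -ltnS ltn_ord andbT.
    by apply: contra iJ => /eqP iJ; apply/eqP/val_inj.
  rewrite big_split /=; have <- : \sum_x 2 * w x = \sum_i \sum_(x | c x == i) 2 * w x.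
    by rewrite (partition_big c xpredT).
  rewrite -mulr_sumr sumr_const card_ord mulrSr.
  by have := up_log_le_log2 R X_gt0; rewrite -/J; lra.
exists (h \o code) => x wx_gt0; apply: le_trans (c_up x wx_gt0).
rewrite ler_nat; have m_gt0 : (0 < 2 ^ c x)%N by rewrite expn_gt0.
rewrite -[leqRHS]card_ord.
(* Within one block the rank modulo the block size is injective, so the block has at most [2 ^ c x]
   elements. *)
pose g x' : 'I_(2 ^ c x) := Ordinal (ltn_pmod (r x') m_gt0).
apply: (@leq_trans #|g @: [set x' | (h \o code) x' == (h \o code) x]|); last first.
  exact: max_card.
rewrite card_in_imset// => x1 x2; rewrite !inE /=.
have codeP y : h (code y) == h (code x) ->
    c y = c x /\ (r y %/ 2 ^ c x = r x %/ 2 ^ c x)%N.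
  move=> /eqP/h_inj eq_code.
  have cy : c y = c x by exact: (congr1 tag eq_code).
  split=> //; rewrite -{1}cy.
  exact: (congr1 (fun u : {i & 'I_(n_ i)} => nat_of_ord (tagged u)) eq_code).
move=> /codeP[c1 q1] /codeP[c2 q2] /(congr1 val) /= r12.
have : r x1 = r x2.
  by rewrite (divn_eq (r x1) (2 ^ c x)) (divn_eq (r x2) (2 ^ c x)) q1 q2 r12.
rewrite /r c1 c2 => /(congr1 (nth x1 (enum (Xc (c x))))).
by rewrite !nth_index// mem_enum inE ?c1 ?c2.
Qed.

(** * The Renyi sum and expectations under an encoder *)

Definition renyi_sum (R : realType) (rho : R) (X Y : finType) (P : X * Y -> R)
    (y : Y) : R :=
  (\sum_x P (x, y) `^ (1 / (1 + rho))) `^ (1 + rho).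

Lemma renyi_sum_gt0 (R : realType) (rho : R) (X Y : finType) (P : X * Y -> R) :
  0 < rho -> is_pmf P -> 0 < \sum_y renyi_sum rho P y.
Proof.
move=> rho_gt0 [P_ge0 P_sum1].
rewrite lt_def sumr_ge0 ?andbT => [|y _]; last exact: powR_ge0.
apply/eqP => S0; have : \sum_xy P xy != 0 by rewrite P_sum1 oner_neq0.
rewrite big1 ?eqxx// => -[x y] _.
have /powR_eq0_eq0 T0 : renyi_sum rho P y = 0.
  by apply: (psumr_eq0P _ S0) => // i _; exact: powR_ge0.
apply: powR_eq0_eq0; apply: (psumr_eq0P _ T0) => // i _; exact: powR_ge0.
Qed.

(** For [alpha = 1 / (1 + rho)] the prefactor [alpha / (1 - alpha)] is [1 / rho], so the exponent
    reduces to the bare logarithm. *)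
Lemma powR2_renyi (R : realType) (rho : R) (X Y : finType) (P : X * Y -> R) :
  0 < rho -> is_pmf P ->
  2 `^ (rho * renyi_entropy (1 / (1 + rho)) P) = \sum_y renyi_sum rho P y.
Proof.
move=> rho_gt0 P_pmf; have rho1_gt0 : 0 < 1 + rho by rewrite addr_gt0.
have rho_neq0 : rho != 0 by rewrite gt_eqF.
have rho1_neq0 : 1 + rho != 0 by rewrite gt_eqF.
rewrite -[RHS]powR2_log2 ?renyi_sum_gt0//; congr (_ `^ _).
rewrite /renyi_entropy /renyi_sum div1r invrK mulrA -[RHS]mul1r; congr (_ * _).
have -> : 1 - (1 + rho)^-1 = rho / (1 + rho) by field.
by field; rewrite rho1_neq0 rho_neq0.
Qed.

Lemma powR2_renyiB (R : realType) (rho a : R) (X Y : finType) (P : X * Y -> R) :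
  0 < rho -> is_pmf P -> 0 < a ->
  2 `^ (rho * (renyi_entropy (1 / (1 + rho)) P - log2 a)) =
  (\sum_y renyi_sum rho P y) / a `^ rho.
Proof.
move=> rho_gt0 P_pmf a_gt0; rewrite mulrBr powRB ?pnatr_eq0 ?implybT//.
by rewrite powR2_renyi// [rho * log2 a]mulrC powRrM powR2_log2.
Qed.

Lemma joint_ge0 (R : realType) (X Y M1 M2 : finType) (P : X * Y -> R)
    (e : X -> Y -> M1 * M2 -> R) :
  is_pmf P -> is_encoder e -> forall x y m1 m2, 0 <= joint P e x y m1 m2.
Proof. by move=> [P_ge0 _] enc x y m1 m2; rewrite mulr_ge0//; case: (enc x y). Qed.

Lemma le_expectation (R : realType) (X Y M1 M2 : finType) (P : X * Y -> R)
    (e : X -> Y -> M1 * M2 -> R) (f g : X -> Y -> M1 -> M2 -> R) :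
  is_pmf P -> is_encoder e ->
  (forall x y m1 m2, 0 < joint P e x y m1 m2 -> f x y m1 m2 <= g x y m1 m2) ->
  expectation P e f <= expectation P e g.
Proof.
move=> P_pmf enc le_fg; do 4! [apply: ler_sum => ? _].
set j := joint _ _ _ _ _ _; have : 0 <= j by exact: joint_ge0.
by rewrite le_eqVlt => /predU1P[<-|j_gt0]; rewrite ?mul0r// ler_pM2l// le_fg.
Qed.

Lemma expectation_pair (R : realType) (X Y M1 M2 : finType) (P : X * Y -> R)
    (e : X -> Y -> M1 * M2 -> R) (f : X -> Y -> M1 -> M2 -> R) :
  expectation P e f =
  \sum_x \sum_y P (x, y) * \sum_m e x y m * f x y m.1 m.2.
Proof.
apply: eq_bigr => x _; apply: eq_bigr => y _.
rewrite pair_bigA mulr_sumr; apply: eq_bigr => -[m1 m2] _.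
by rewrite /joint mulrA.
Qed.

Lemma expectation_source (R : realType) (X Y M1 M2 : finType) (P : X * Y -> R)
    (e : X -> Y -> M1 * M2 -> R) (f : X -> Y -> R) :
  is_encoder e ->
  expectation P e (fun x y _ _ => f x y) = \sum_x \sum_y P (x, y) * f x y.
Proof.
move=> enc; rewrite expectation_pair; apply: eq_bigr => x _.
by apply: eq_bigr => y _; rewrite -mulr_suml; case: (enc x y) => _ ->; rewrite mul1r.
Qed.

Lemma mem_bob_list (R : realType) (X Y M1 M2 : finType) (P : X * Y -> R)
    (e : X -> Y -> M1 * M2 -> R) (x : X) (y : Y) (m1 : M1) (m2 : M2) :
  is_pmf P -> is_encoder e ->
  (x \in bob_list P e y m1 m2) = (0 < joint P e x y m1 m2).
Proof.
move=> P_pmf enc; have j_ge0 := joint_ge0 P_pmf enc; rewrite inE /posterior.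
apply/idP/idP => [|j_gt0].
  by apply: contraTT; rewrite -!leNgt => j_le0; rewrite mulr_le0_ge0 ?invr_ge0 ?sumr_ge0.
by rewrite divr_gt0// (bigD1 x)//= ltr_pwDl// sumr_ge0.
Qed.

Lemma ge1_powR_nat (R : realType) (rho : R) (n : nat) :
  0 < rho -> (0 < n)%N -> 1 <= n%:R `^ rho.
Proof.
move=> rho_gt0 n_gt0; rewrite -[leLHS](congr1 (@^~ rho) (powR1 R)).
by rewrite ge0_ler_powR ?nnegrE ?ler1n// ltW.
Qed.

(** * Converse bounds on Bob's list ambiguity *)

(** The true [x] lies in every list that occurs with it, so no such list is empty. *)
Lemma bob_ambiguity_ge1 (R : realType) (rho : R) (X Y M1 M2 : finType)
    (P : X * Y -> R) (e : X -> Y -> M1 * M2 -> R) :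
  0 < rho -> is_pmf P -> is_encoder e -> 1 <= bob_ambiguity rho P e.
Proof.
move=> rho_gt0 P_pmf enc.
have <- : expectation P e (fun _ _ _ _ => 1) = 1.
  rewrite (@expectation_source _ _ _ _ _ P e (fun _ _ => 1))// pair_bigA.
  under eq_bigr do rewrite mulr1 -surjective_pairing.
  by case: P_pmf.
apply: le_expectation => // x y m1 m2; rewrite -mem_bob_list// => xL.
by rewrite ge1_powR_nat//; apply/card_gt0P; exists x.
Qed.

Lemma sum_pair (V : nmodType) (I J : finType) (F : I * J -> V) :
  \sum_t F t = \sum_i \sum_j F (i, j).
Proof. by rewrite pair_bigA; apply: eq_bigr => -[]. Qed.

(** For fixed [y], [powR_sum_le] is applied to the joint masses of the triples [(x, (m1, m2))] with
    [x] in the list, weighted by list size. *)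
Lemma renyi_le_bob (R : realType) (rho : R) (X Y M1 M2 : finType)
    (P : X * Y -> R) (e : X -> Y -> M1 * M2 -> R) :
  0 < rho -> is_pmf P -> is_encoder e ->
  \sum_y renyi_sum rho P y <= bob_ambiguity rho P e * (#|M1| * #|M2|)%:R `^ rho.
Proof.
move=> rho_gt0 P_pmf enc; have j_ge0 := joint_ge0 P_pmf enc.
have /andP[alpha_gt0 alpha_lt1] := order_in01 rho_gt0.
rewrite /bob_ambiguity /expectation exchange_big mulr_suml ler_sum// => y _.
pose L (t : X * (M1 * M2)) := bob_list P e y t.2.1 t.2.2.
pose j (t : X * (M1 * M2)) := joint P e t.1 y t.2.1 t.2.2.
have -> : \sum_x \sum_m1 \sum_m2
    joint P e x y m1 m2 * #|bob_list P e y m1 m2|%:R `^ rho =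
    \sum_(t | t.1 \in L t) j t * #|L t|%:R `^ rho.
  under [LHS]eq_bigr do rewrite pair_bigA.
  rewrite pair_bigA [RHS]big_mkcond; apply: eq_bigr => -[x [m1 m2]] _ /=.
  rewrite /L /j mem_bob_list//=; case: ltP => // j_le0.
  suff -> : joint P e x y m1 m2 = 0 by rewrite mul0r.
  by apply/eqP; rewrite eq_le j_le0 j_ge0.
have L_neq0 t : t.1 \in L t -> #|L t|%:R != 0 :> R.
  by move=> tL; rewrite pnatr_eq0 -lt0n; apply/card_gt0P; exists t.1.
(* Splitting [P (x, y)] over the messages does not decrease the sum of powers: the conditional
   probabilities [q] sum to 1 and satisfy [q <= q ^ (1 / (1 + rho))]. *)
apply: (@le_trans _ _ ((\sum_(t | t.1 \in L t) j t `^ (1 / (1 + rho))) `^ (1 + rho))).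
  apply: ge0_ler_powR; rewrite ?nnegrE ?addr_ge0 ?(ltW rho_gt0)//.
  - by rewrite sumr_ge0// => x _; exact: powR_ge0.
  - by rewrite sumr_ge0// => x _; exact: powR_ge0.
  rewrite [leRHS]big_mkcond sum_pair /=.
  apply: ler_sum => x _; case: (enc x y) => e_ge0 e_sum1.
  rewrite -[leLHS]mulr1 -[X in _ * X <= _]e_sum1 mulr_sumr ler_sum// => m _.
  have j_gt0 : (x \in L (x, m)) = (0 < j (x, m)) by rewrite /L mem_bob_list.
  rewrite j_gt0; case: ltP => [_|].
    rewrite {1}/j /joint /= -surjective_pairing powRM//; last by case: P_pmf.
    rewrite ler_wpM2l ?powR_ge0//; have := e_ge0 m.
    rewrite le_eqVlt => /predU1P[<-|e_gt0]; first exact: powR_ge0.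
    rewrite ger1_powR ?(ltW alpha_lt1)// e_gt0 /=.
    by rewrite -e_sum1 (bigD1 m)//= lerDl sumr_ge0.
  rewrite /j /joint /= -surjective_pairing => j_le0.
  have /eqP : P (x, y) * e x y m = 0.
    by apply/eqP; rewrite eq_le j_le0 mulr_ge0//; case: P_pmf.
  rewrite mulf_eq0 => /orP[/eqP->|/eqP->]; last by rewrite mulr0.
  by rewrite powR0 ?mul0r// gt_eqF.
have := @powR_sum_le R rho _ (fun t => t.1 \in L t) j (fun t => #|L t|%:R) rho_gt0.
move=> /(_ (fun t => j_ge0 _ _ _ _) (fun t => ler0n _ _) L_neq0) => /le_trans; apply.
rewrite ler_wpM2l//.
  by rewrite sumr_ge0// => t _; rewrite mulr_ge0 ?powR_ge0 ?j_ge0.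
have sum_ge0 : 0 <= \sum_(t | t.1 \in L t) (#|L t|%:R : R)^-1.
  by rewrite sumr_ge0// => t _; rewrite invr_ge0.
apply: ge0_ler_powR; rewrite ?nnegrE ?(ltW rho_gt0)//.
rewrite [leLHS]big_mkcond sum_pair exchange_big /=.
rewrite -card_prod -sum1_card natr_sum ler_sum// => m _.
rewrite -big_mkcond /= /L /= sumr_const -[_ *+ _]mulr_natl.
case: (posnP #|bob_list P e y m.1 m.2|) => [->|?]; rewrite ?mul0r//.
by rewrite mulfV// pnatr_eq0 -lt0n.
Qed.

(** * Upper bounds on Eve's ambiguity *)

(** Only the guesser who sees [M1] follows the key; the other may use any order, as the minimum is
    at most the first cost. *)
Lemma eve_le_key1 (R : realType) (rho : R) (X Y M1 M2 : finType)
    (P : X * Y -> R) (e : X -> Y -> M1 * M2 -> R) (k : Y * M1 -> X -> R)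
    (n : X -> Y -> M1 -> M2 -> nat) :
  0 < rho -> is_pmf P -> is_encoder e ->
  (forall x y m1 m2, 0 < joint P e x y m1 m2 ->
     (#|[set x' | (k (y, m1) x' <= k (y, m1) x)%R]| <= n x y m1 m2)%N) ->
  eve_ambiguity rho P e <=
  expectation P e (fun x y m1 m2 => (n x y m1 m2)%:R `^ rho).
Proof.
move=> rho_gt0 P_pmf enc k_le; have [G [Gg G_le]] := exists_guessing k.
have [_ eve_min] := eve_ambiguityP rho P e.
apply: le_trans (eve_min _ _ Gg (guess0_is_guessing _ _)) _.
apply: le_expectation => // x y m1 m2 j_gt0 /=.
rewrite ge_min; apply/orP; left; apply: ge0_ler_powR; rewrite ?nnegrE ?(ltW rho_gt0)//.
by rewrite ler_nat (leq_trans (G_le _ _))// k_le.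
Qed.

Lemma eve_le_key2 (R : realType) (rho : R) (X Y M1 M2 : finType)
    (P : X * Y -> R) (e : X -> Y -> M1 * M2 -> R) (k : Y * M2 -> X -> R)
    (n : X -> Y -> M1 -> M2 -> nat) :
  0 < rho -> is_pmf P -> is_encoder e ->
  (forall x y m1 m2, 0 < joint P e x y m1 m2 ->
     (#|[set x' | (k (y, m2) x' <= k (y, m2) x)%R]| <= n x y m1 m2)%N) ->
  eve_ambiguity rho P e <=
  expectation P e (fun x y m1 m2 => (n x y m1 m2)%:R `^ rho).
Proof.
move=> rho_gt0 P_pmf enc k_le; have [G [Gg G_le]] := exists_guessing k.
have [_ eve_min] := eve_ambiguityP rho P e.
apply: le_trans (eve_min _ _ (guess0_is_guessing _ _) Gg) _.
apply: le_expectation => // x y m1 m2 j_gt0 /=.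
rewrite ge_min; apply/orP; right; apply: ge0_ler_powR; rewrite ?nnegrE ?(ltW rho_gt0)//.
by rewrite ler_nat (leq_trans (G_le _ _))// k_le.
Qed.

Lemma expectation_scaled_lists (R : realType) (rho : R) (X Y M1 M2 : finType)
    (P : X * Y -> R) (e : X -> Y -> M1 * M2 -> R) (n : nat) :
  expectation P e
    (fun _ y m1 m2 => (n * #|bob_list P e y m1 m2|)%:R `^ rho) =
  n%:R `^ rho * bob_ambiguity rho P e.
Proof.
rewrite /bob_ambiguity /expectation; do 4! [rewrite mulr_sumr; apply: eq_bigr => ? _].
by rewrite natrM powRM// mulrCA.
Qed.

(** The guesser who sees [m2] faces one candidate list for each [m1], whence the factor [#|M1|];
    [exists_list_key] exhausts the short ones first. *)
Lemma eve_le_bob1 (R : realType) (rho : R) (X Y M1 M2 : finType)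
    (P : X * Y -> R) (e : X -> Y -> M1 * M2 -> R) :
  0 < rho -> is_pmf P -> is_encoder e ->
  eve_ambiguity rho P e <= #|M1|%:R `^ rho * bob_ambiguity rho P e.
Proof.
move=> rho_gt0 P_pmf enc; rewrite -expectation_scaled_lists.
have /fin_all_exists[k kP] (w : Y * M2) :=
  exists_list_key R (fun m1 => bob_list P e w.1 m1 w.2).
by apply: (eve_le_key2 (k := k)) => // x y m1 m2 j_gt0; apply: kP; rewrite mem_bob_list.
Qed.

Lemma eve_le_bob2 (R : realType) (rho : R) (X Y M1 M2 : finType)
    (P : X * Y -> R) (e : X -> Y -> M1 * M2 -> R) :
  0 < rho -> is_pmf P -> is_encoder e ->
  eve_ambiguity rho P e <= #|M2|%:R `^ rho * bob_ambiguity rho P e.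
Proof.
move=> rho_gt0 P_pmf enc; rewrite -expectation_scaled_lists.
have /fin_all_exists[k kP] (w : Y * M1) :=
  exists_list_key R (fun m2 => bob_list P e w.1 w.2 m2).
by apply: (eve_le_key1 (k := k)) => // x y m1 m2 j_gt0; apply: kP; rewrite mem_bob_list.
Qed.

(* Guessing in decreasing order of probability bounds the rank of [x] by
   [\sum_x' (P (x', y) / P (x, y)) ^ (1 / (1 + rho))]. *)
Lemma eve_le_renyi (R : realType) (rho : R) (X Y M1 M2 : finType)
    (P : X * Y -> R) (e : X -> Y -> M1 * M2 -> R) :
  0 < rho -> is_pmf P -> is_encoder e ->
  eve_ambiguity rho P e <= \sum_y renyi_sum rho P y.
Proof.
move=> rho_gt0 P_pmf enc; have P_ge0 := P_pmf.1.
have /andP[alpha_gt0 _] := order_in01 rho_gt0.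
pose k (w : Y * M1) x := - P (x, w.1).
have := eve_le_key1 (k := k) rho_gt0 P_pmf enc (fun _ _ _ _ _ => leqnn _).
rewrite (@expectation_source _ _ _ _ _ _ _
  (fun x y => #|[set x' | - P (x', y) <= - P (x, y)]|%:R `^ rho))//.
rewrite exchange_big => /le_trans; apply; apply: ler_sum => y _.
set T := \sum_x P (x, y) `^ (1 / (1 + rho)).
have T_ge0 : 0 <= T by rewrite sumr_ge0// => x _; exact: powR_ge0.
have -> : renyi_sum rho P y = \sum_x P (x, y) `^ (1 / (1 + rho)) * T `^ rho.
  rewrite -mulr_suml -/T /renyi_sum -/T powRD ?powRr1//.
  by rewrite gt_eqF// addr_gt0.
apply: ler_sum => x _; rewrite -mul_powR_div//.
have := P_ge0 (x, y); rewrite le_eqVlt => /predU1P[<-|Pxy_gt0]; first by rewrite !mul0r.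
rewrite ler_pM2l//; apply: ge0_ler_powR;
  rewrite ?nnegrE ?divr_ge0 ?powR_ge0 ?(ltW rho_gt0)//.
rewrite ler_pdivlMr ?powR_gt0// -sum1_card natr_sum mulr_suml big_mkcond.
apply: ler_sum => x' _; rewrite inE lerN2; case: ifP => [le_P|_]; last exact: powR_ge0.
by rewrite [leLHS]mul1r; apply: ge0_ler_powR; rewrite ?nnegrE// ltW.
Qed.

(** * Direct part: block codes and keyed encoders *)

(** Weights proportional to [p ^ (1 / (1 + rho))] control the block sizes, and
    [max (1, t) ^ rho <= 1 + t ^ rho] produces the two terms. *)
Lemma task_encoder_cost (R : realType) (rho : R) (X Z : finType) (p : X -> R) :
  0 < rho -> (0 < #|X|)%N -> (forall x, 0 <= p x) ->
  log2 #|X|%:R + 2 < #|Z|%:R :> R ->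
  exists f : X -> Z,
    \sum_x p x * #|[set x' | f x' == f x]|%:R `^ rho <=
    \sum_x p x + (\sum_x p x `^ (1 / (1 + rho))) `^ (1 + rho) *
      (2 / (#|Z|%:R - log2 #|X|%:R - 2)) `^ rho.
Proof.
move=> rho_gt0 X_gt0 p_ge0 Z_gt; have /andP[alpha_gt0 _] := order_in01 rho_gt0.
set D := _ - _ - 2; have D_gt0 : 0 < D by rewrite /D; lra.
set T := \sum_x p x `^ _.
have T_ge0 : 0 <= T by rewrite sumr_ge0// => x _; exact: powR_ge0.
(* For nonzero [T] this value makes [2 * \sum_x w x] equal to [D], the number of blocks left after
   [log |X| + 2]. *)
pose c := T * (2 / D); have c_ge0 : 0 <= c by rewrite mulr_ge0// divr_ge0// ltW.
pose w x := p x `^ (1 / (1 + rho)) / c.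
have w_ge0 x : 0 <= w x by rewrite divr_ge0 ?powR_ge0.
have sum_w : 2 * \sum_x w x <= D.
  rewrite -mulr_suml -/T /c; have [->|T_neq0] := eqVneq T 0.
    by rewrite mul0r mulr0 ltW.
  by rewrite le_eqVlt; apply/orP; left; apply/eqP; field; rewrite T_neq0 gt_eqF.
have [|f f_le] := @exists_task_encoder R X Z w X_gt0 w_ge0.
  by rewrite /D in sum_w; lra.
exists f; have -> : T `^ (1 + rho) * (2 / D) `^ rho =
    \sum_x p x `^ (1 / (1 + rho)) * c `^ rho.
  rewrite -mulr_suml -/T powRD; last by rewrite gt_eqF// addr_gt0.
  by rewrite powRr1// /c powRM ?divr_ge0 ?(ltW D_gt0)// mulrA.
rewrite -big_split ler_sum// => x _ /=; rewrite -mul_powR_div// -{2}[p x]mulr1 -mulrDr.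
have := p_ge0 x; rewrite le_eqVlt => /predU1P[<-|px_gt0]; first by rewrite !mul0r.
rewrite ler_pM2l//.
have T_gt0 : 0 < T.
  by rewrite /T (bigD1 x)//= ltr_pwDl ?powR_gt0// sumr_ge0// => i _; exact: powR_ge0.
have wx_gt0 : 0 < w x by rewrite !(divr_gt0, mulr_gt0, powR_gt0).
have := f_le x wx_gt0; rewrite /w invf_div le_max => /orP[f1|f1].
  apply: (@le_trans _ _ 1); last by rewrite lerDl powR_ge0.
  rewrite -[leRHS](congr1 (@^~ rho) (powR1 R)).
  by apply: ge0_ler_powR; rewrite ?nnegrE ?(ltW rho_gt0).
apply: (@le_trans _ _ ((c / p x `^ (1 / (1 + rho))) `^ rho)); last by rewrite lerDr.
by apply: ge0_ler_powR; rewrite ?nnegrE ?(ltW rho_gt0)// divr_ge0 ?powR_ge0.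
Qed.

(** The law of [F x y u] for a key [u] uniform on [U]. *)
Definition keyed_encoder (R : realType) (X Y U M : finType)
    (F : X -> Y -> U -> M) (x : X) (y : Y) (m : M) : R :=
  \sum_u (F x y u == m)%:R / #|U|%:R.

Lemma sum_keyed_encoder (R : realType) (X Y U M : finType)
    (F : X -> Y -> U -> M) (x : X) (y : Y) (f : M -> R) :
  \sum_m keyed_encoder R F x y m * f m = (\sum_u f (F x y u)) / #|U|%:R.
Proof.
under eq_bigr do rewrite mulr_suml; rewrite exchange_big mulr_suml.
apply: eq_bigr => u _; rewrite (bigD1 (F x y u))//= eqxx big1 ?addr0.
  by rewrite mul1r mulrC.
by move=> m /negPf mF; rewrite eq_sym mF !mul0r.
Qed.

Lemma keyed_encoder_pmf (R : realType) (X Y U M1 M2 : finType)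
    (F : X -> Y -> U -> M1 * M2) :
  (0 < #|U|)%N -> is_encoder (keyed_encoder R F).
Proof.
move=> U_gt0 x y; split=> [m|].
  by rewrite sumr_ge0// => u _; rewrite divr_ge0.
transitivity (\sum_m keyed_encoder R F x y m * 1).
  by apply: eq_bigr => m _; rewrite mulr1.
by rewrite sum_keyed_encoder sumr_const mulfV// pnatr_eq0 -lt0n.
Qed.

(** As a message pair determines the block [f y x], every [x'] in Bob's list shares the block of the
    true [x]. *)
Lemma bob_keyed_le (R : realType) (rho : R) (X Y U M1 M2 Z : finType)
    (P : X * Y -> R) (F : X -> Y -> U -> M1 * M2) (f : Y -> X -> Z) :
  0 < rho -> is_pmf P -> (0 < #|U|)%N ->
  (forall x x' y u u', F x y u = F x' y u' -> f y x = f y x') ->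
  bob_ambiguity rho P (keyed_encoder R F) <=
  \sum_y \sum_x P (x, y) * #|[set x' | f y x' == f y x]|%:R `^ rho.
Proof.
move=> rho_gt0 P_pmf U_gt0 decode.
have enc : is_encoder (keyed_encoder R F) by exact: keyed_encoder_pmf.
rewrite exchange_big -(expectation_source P (fun x y =>
  #|[set x' | f y x' == f y x]|%:R `^ rho) enc).
have joint_keyed x y m1 m2 : 0 < joint P (keyed_encoder R F) x y m1 m2 ->
    exists u, F x y u = (m1, m2).
  move=> j_gt0; suff /existsP[u /eqP Fu] : [exists u, F x y u == (m1, m2)] by exists u.
  apply: contraTT j_gt0 => /existsPn FN.
  rewrite /joint /keyed_encoder big1 ?mulr0 ?ltxx// => u _.
  by rewrite (negPf (FN u)) mul0r.
apply: le_expectation => // x y m1 m2 /joint_keyed[u Fu].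
apply: ge0_ler_powR; rewrite ?nnegrE ?(ltW rho_gt0)// ler_nat.
apply: subset_leq_card; apply/fintype.subsetP => x'.
rewrite mem_bob_list// inE => /joint_keyed[u' Fu'].
by apply/eqP; apply: (decode _ _ _ u' u); rewrite Fu Fu'.
Qed.

(** * Lower bound on Eve's ambiguity under padding *)

Lemma sum_guess_inv (R : realType) (X W : finType) (G : guess_table X W) (w : W) :
  is_guessing G ->
  \sum_x ((guess G x w)%:R : R)^-1 = \sum_(i < #|X|) (i.+1%:R : R)^-1.
Proof.
move=> /forallP/(_ w)/asboolP G_bij.
by rewrite [RHS](reindex (G w))//; exact: onW_bij.
Qed.

Lemma min_powR (R : realType) (rho a b : R) : 0 < rho -> 0 <= a -> 0 <= b ->
  Num.min (a `^ rho) (b `^ rho) = (Num.min a b) `^ rho.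
Proof.
move=> rho_gt0 a_ge0 b_ge0; case: (leP a b) => [ab|/ltW ba].
  by apply/min_idPl; apply: ge0_ler_powR; rewrite ?nnegrE ?(ltW rho_gt0).
by apply/min_idPr; apply: ge0_ler_powR; rewrite ?nnegrE ?(ltW rho_gt0).
Qed.

(* The key [u] is a one-time pad for [(f y x).1]; over all sources [x] and all
   keys [u], each pair (pad, public part) seen by a guesser selects one ranking,
   and the reciprocals of the ranks in it sum to a harmonic number. *)
Lemma sum_padded_guess_inv (R : realType) (X V W : finType) (n : nat)
    (G : guess_table X W) (i : 'I_n.+1 * V -> W) (a : X -> 'I_n.+1) (v : X -> V) :
  (0 < #|X|)%N -> is_guessing G ->
  \sum_x \sum_u ((guess G x (i (a x + u, v x)))%:R : R)^-1 <=
  (n.+1 * #|V|)%:R * (1 + ln #|X|%:R).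
Proof.
move=> X_gt0 Gg.
(* The shift by [a x] permutes the keys, and adding the terms of all other public parts removes the
   dependence on [v x]. *)
apply: (@le_trans _ _ (\sum_x \sum_s ((guess G x (i s))%:R : R)^-1)).
  apply: ler_sum => x _.
  have <- : \sum_s ((guess G x (i (s, v x)))%:R : R)^-1 =
      \sum_u ((guess G x (i (a x + u, v x)))%:R : R)^-1.
    by rewrite (reindex_inj (addrI (a x))).
  rewrite sum_pair ler_sum// => s _.
  by rewrite (bigD1 (v x))//= lerDl sumr_ge0// => ? _; rewrite invr_ge0.
rewrite exchange_big /= mulr_natl.
have <- : \sum_(s : 'I_n.+1 * V) (1 + ln #|X|%:R) =
    (1 + ln #|X|%:R : R) *+ (n.+1 * #|V|).
  by rewrite sumr_const card_prod card_ord.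
by rewrite ler_sum// => s _; rewrite sum_guess_inv//; exact: harmonic_le.
Qed.

(** For fixed [y], the pairs [(x, u)] give a factor [n.+1 ^ (1 + rho)] on the Renyi side, against
    [n.+1 ^ rho] from the reciprocals and [n.+1] from the mean over keys. The number of keys thus
    cancels. *)
Lemma eve_padded_ge (R : realType) (rho : R) (X Y M1 M2 V1 V2 : finType) (n : nat)
    (P : X * Y -> R) (i1 : 'I_n.+1 * V1 -> M1) (i2 : 'I_n.+1 * V2 -> M2)
    (f : Y -> X -> 'I_n.+1 * (V1 * V2)) :
  0 < rho -> is_pmf P -> (0 < #|X|)%N ->
  \sum_y renyi_sum rho P y <=
  eve_ambiguity rho P (keyed_encoder R (fun x y u =>
    (i1 ((f y x).1 + u, (f y x).2.1), i2 (u, (f y x).2.2)))) *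
  ((#|V1| + #|V2|)%:R * (1 + ln #|X|%:R)) `^ rho.
Proof.
move=> rho_gt0 [P_ge0 _] X_gt0; set F := (X in keyed_encoder R X).
have [[G1 [G2 [G1g G2g ->]]] _] := eve_ambiguityP rho P (keyed_encoder R F).
set K := _%:R * _.
have K_ge0 : 0 <= K by rewrite mulr_ge0// addr_ge0// ln_ge0// ler1n.
rewrite /eve_cost expectation_pair exchange_big mulr_suml ler_sum// => y _.
pose g (t : X * 'I_n.+1) : R :=
  Num.min (guess G1 t.1 (y, (F t.1 y t.2).1))%:R (guess G2 t.1 (y, (F t.1 y t.2).2))%:R.
have g_gt0 t : 0 < g t by rewrite lt_min !ltr0n.
have N_gt0 : 0 < n.+1%:R :> R by rewrite ltr0n.
have -> : \sum_x P (x, y) * (\sum_m keyed_encoder R F x y m *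
    Num.min ((guess G1 x (y, m.1))%:R `^ rho) ((guess G2 x (y, m.2))%:R `^ rho)) =
    (\sum_t P (t.1, y) * g t `^ rho) / n.+1%:R.
  rewrite sum_pair mulr_suml; apply: eq_bigr => x _.
  rewrite (@sum_keyed_encoder R X Y _ _ F x y (fun m =>
    Num.min ((guess G1 x (y, m.1))%:R `^ rho) ((guess G2 x (y, m.2))%:R `^ rho))).
  rewrite card_ord mulrA mulr_sumr; congr (_ / _).
  by apply: eq_bigr => u _; rewrite min_powR.
have g_neq0 t : true -> g t != 0 by rewrite gt_eqF.
have := powR_sum_le rho_gt0 (fun t => P_ge0 (t.1, y)) (fun t => ltW (g_gt0 t)) g_neq0.
have -> : \sum_(t : X * 'I_n.+1) P (t.1, y) `^ (1 / (1 + rho)) =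
    n.+1%:R * \sum_x P (x, y) `^ (1 / (1 + rho)).
  rewrite sum_pair mulr_sumr; apply: eq_bigr => x _ /=.
  by rewrite sumr_const card_ord mulr_natl.
set S := (X in _ <= X * _) => S_ge.
have S_ge0 : 0 <= S by rewrite sumr_ge0// => t _; rewrite mulr_ge0 ?powR_ge0.
have inv_le : \sum_t (g t)^-1 <= n.+1%:R * K.
  rewrite sum_pair; apply: (@le_trans _ _ (\sum_x \sum_u
      ((guess G1 x (y, (F x y u).1))%:R^-1 + (guess G2 x (y, (F x y u).2))%:R^-1))).
    apply: ler_sum => x _; apply: ler_sum => u _.
    by rewrite /g /= minElt; case: ifP => _; rewrite ?lerDl ?lerDr invr_ge0.
  under eq_bigr do rewrite big_split.
  rewrite big_split /= /K mulrA -natrM mulnDr natrD mulrDl.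
  apply: lerD.
    exact: (@sum_padded_guess_inv R X V1 _ n G1 (fun s => (y, i1 s))
      (fun x => (f y x).1) (fun x => (f y x).2.1)).
  (* The second message carries the key itself, a pad with shift 0. *)
  have := @sum_padded_guess_inv R X V2 _ n G2 (fun s => (y, i2 s))
    (fun=> 0) (fun x => (f y x).2.2) X_gt0 G2g.
  apply: le_trans; apply: ler_sum => x _; apply: ler_sum => u _.
  by rewrite [in leRHS]add0r.
have : (n.+1%:R * \sum_x P (x, y) `^ (1 / (1 + rho))) `^ (1 + rho) <=
    S * (n.+1%:R * K) `^ rho.
  apply: (le_trans S_ge); rewrite ler_wpM2l//.
  have sum_ge0 : 0 <= \sum_t (g t)^-1 by rewrite sumr_ge0// => t _; rewrite invr_ge0 ltW.
  by apply: ge0_ler_powR; rewrite ?nnegrE ?(ltW rho_gt0)// mulr_ge0.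
have T_ge0 : 0 <= \sum_x P (x, y) `^ (1 / (1 + rho)).
  by rewrite sumr_ge0// => x _; exact: powR_ge0.
rewrite (powRM _ (ltW N_gt0) T_ge0) (powRM _ (ltW N_gt0) K_ge0).
rewrite -/(renyi_sum rho P y) powRD; last by rewrite gt_eqF// addr_gt0.
rewrite powRr1// [n.+1%:R * _]mulrC -[_ * _ * renyi_sum _ _ _]mulrA [S * _]mulrCA.
rewrite ler_pM2l ?powR_gt0// => le_S.
by rewrite mulrAC ler_pdivlMr// mulrC.
Qed.

(** * Assembly of the converse and direct bounds *)

Theorem theorem2 (R : realType) (rho : R) (X Y M1 M2 : finType)
    (P : X * Y -> R) (rho_gt0 : 0 < rho)
    (X_gt0 : (0 < #|X|)%N) (Y_gt0 : (0 < #|Y|)%N)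
    (M1_gt0 : (0 < #|M1|)%N) (M2_gt0 : (0 < #|M2|)%N)
    (P_pmf : is_pmf P) :
  let H := renyi_entropy (1 / (1 + rho)) P in
  let logX := log2 (#|X|%:R : R) in
  ((#|M1| * #|M2|)%:R > logX + 2 ->
   forall cs c1 c2 : nat,
     (0 < cs)%N -> (0 < c1)%N -> (0 < c2)%N ->
     (cs <= minn #|M1| #|M2|)%N ->
     (c1 <= #|M1| %/ cs)%N ->
     (c2 <= #|M2| %/ cs)%N ->
     (cs * c1 * c2)%:R > logX + 2 ->
     exists e : X -> Y -> M1 * M2 -> R,
       [/\ is_encoder e,
           bob_ambiguity rho P e <
             1 + 2 `^ (rho * (H - log2 ((cs * c1 * c2)%:R - logX - 2) + 2)) &
           eve_ambiguity rho P e >=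
             (1 + ln #|X|%:R) `^ (- rho)
               * 2 `^ (rho * (H - log2 (c1 + c2)%:R))])
  /\
  (forall e : X -> Y -> M1 * M2 -> R, is_encoder e ->
     bob_ambiguity rho P e >=
       Num.max (2 `^ (rho * (H - log2 (#|M1| * #|M2|)%:R))) 1
     /\
     eve_ambiguity rho P e <=
       Num.min (Num.min (#|M1|%:R `^ rho) (#|M2|%:R `^ rho)
                  * bob_ambiguity rho P e)
               (2 `^ (rho * H))).
Proof.
move=> H logX; have P_ge0 := P_pmf.1; split; last first.
  move=> e enc; split; rewrite ?ge_max ?le_min.
    rewrite bob_ambiguity_ge1// andbT.
    have M_gt0 : 0 < (#|M1| * #|M2|)%:R :> R by rewrite ltr0n muln_gt0 M1_gt0.
    rewrite /H powR2_renyiB// ler_pdivrMr ?powR_gt0//.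
    exact: renyi_le_bob.
  rewrite powR2_renyi// eve_le_renyi// andbT.
  by rewrite minElt; case: ifP => _; rewrite ?eve_le_bob1 ?eve_le_bob2.
(* Writing [cs] as [n.+1] gives the ordinals below it the group structure used for padding. *)
move=> _ [//|n] c1 c2 _ c1_gt0 c2_gt0 _; rewrite !leq_divRL// => c1_le c2_le N_gt.
have [i1 i1_inj] : exists i1 : 'I_n.+1 * 'I_c1 -> M1, injective i1.
  by apply: exists_injection; rewrite card_prod !card_ord mulnC.
have [i2 i2_inj] : exists i2 : 'I_n.+1 * 'I_c2 -> M2, injective i2.
  by apply: exists_injection; rewrite card_prod !card_ord mulnC.
pose Z : finType := ('I_n.+1 * ('I_c1 * 'I_c2))%type.
have cardZ : #|Z| = (n.+1 * c1 * c2)%N by rewrite !card_prod !card_ord mulnA.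
rewrite -cardZ in N_gt *; set D := _ - logX - 2.
have D_gt0 : 0 < D by rewrite /D; lra.
have /fin_all_exists[f f_le] (y : Y) :=
  task_encoder_cost rho_gt0 X_gt0 (fun x => P_ge0 (x, y)) N_gt.
exists (keyed_encoder R (fun x y u =>
  (i1 ((f y x).1 + u, (f y x).2.1), i2 (u, (f y x).2.2)))); split.
- by apply: keyed_encoder_pmf; rewrite card_ord.
- apply: (@le_lt_trans _ _ (1 + (\sum_y renyi_sum rho P y) * (2 / D) `^ rho)).
    apply: le_trans (bob_keyed_le (f := f) rho_gt0 P_pmf _ _) _.
    + by rewrite card_ord.
    (* By injectivity of [i2] the second message reveals [u]; subtracting it from the padded
       coordinate of the first recovers the whole index. *)
    + move=> x x' y u u' eqF.
      have eq1 := i1_inj _ _ (congr1 fst eqF).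
      have eq2 := i2_inj _ _ (congr1 snd eqF).
      have uE : u = u' := congr1 fst eq2.
      have aE : (f y x).1 + u = (f y x').1 + u' := congr1 fst eq1.
      have v1E : (f y x).2.1 = (f y x').2.1 := congr1 snd eq1.
      have v2E : (f y x).2.2 = (f y x').2.2 := congr1 snd eq2.
      have {}aE : (f y x).1 = (f y x').1 by rewrite -[LHS](addrK u) aE uE addrK.
      rewrite [f y x]surjective_pairing [(f y x).2]surjective_pairing.
      by rewrite aE v1E v2E -!surjective_pairing.
    apply: (le_trans (ler_sum _ (fun y _ => f_le y))).
    rewrite big_split exchange_big /= -mulr_suml lerD2r pair_bigA /=.
    by under eq_bigr do rewrite -surjective_pairing; rewrite P_pmf.2.
  (* The 2 in the exponent divides [D] by 4, whereas the block code costs only [(2 / D) ^ rho]; this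
     slack makes the inequality strict. *)
  have -> : H - log2 D + 2 = H - log2 (D / 4).
    have ln2_neq0 : ln 2 != 0 :> R by rewrite gt_eqF// ln_gt0// ltr1n.
    have -> : 4 = 2 ^+ 2 :> R by rewrite -natrX.
    by rewrite /log2 ln_div ?posrE ?exprn_gt0// lnXn// -mulr_natr; field; rewrite mul1r.
  rewrite /H powR2_renyiB ?divr_gt0// ltrD2l ltr_pM2l ?renyi_sum_gt0//.
  rewrite -powRN -[D / 4]invrK invf_div.
  rewrite -[(4 / D)^-1]powR_inv1 ?divr_ge0 ?(ltW D_gt0)// -powRrM mulN1r opprK.
  apply: gt0_ltr_powR; rewrite ?nnegrE ?divr_ge0 ?(ltW D_gt0)//.
  by rewrite ltr_pM2r ?invr_gt0// ltr_nat.
- have h_gt0 : 0 < 1 + ln #|X|%:R :> R by rewrite ltr_pwDl// ln_ge0// ler1n.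
  have c_gt0 : 0 < (c1 + c2)%:R :> R by rewrite ltr0n addn_gt0 c1_gt0.
  rewrite /H powR2_renyiB// powRN mulrCA -invfM.
  rewrite -(powRM _ (ltW h_gt0) (ltW c_gt0)) ler_pdivrMr ?powR_gt0 ?mulr_gt0//.
  have := eve_padded_ge i1 i2 f rho_gt0 P_pmf X_gt0.
  by rewrite !card_ord [_ * (1 + _)]mulrC.
Qed.
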